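(* Let $r\ge 1$ and $c$ be integers, and let $q,Z$ be indeterminates. For $n\ge 0$ put $$P_n(x)=p_n\big(q^{-c}(1+(q-1)x);\,Zq^{-r},\,1\mid q^r\big)\in\mathbb{Q}(q,Z)[x],$$ the shifted little $q$-Jacobi polynomials (base $q^r$, parameters $a=Zq^{-r}$, $b=1$). Let $\mu_n=\varphi(x^n)$ be the $n$th moment of the sequence $(P_n(x))_{n\ge0}$, where $\varphi$ is the linear functional, normalized by $\varphi(1)=1$, with respect to which $(P_n(x))_{n\ge 0}$ is orthogonal. Then for all $n\ge 0$ $$\mu_n=(1-Z)\sum_{k\ge 0}\big([rk+c]_q\big)^n Z^k .$$ Moreover, if $c=1$, then for all $n\ge 1$ $$\mu_n=\frac{G_{r,n}(Z,q)}{(Zq^r;q^r)_n},$$ where $G_{r,n}(Z,q)=\sum_{\gamma\in G(r,n)}Z^{\mathrm{des}_G(\gamma)}q^{\mathrm{fmaj}(\gamma)}$ is the generating polynomial of the group $G(r,n)$ of $r$-coloured permutations.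
   Context: Notation: $[m]_q=\frac{1-q^m}{1-q}$ for $m\in\mathbb{Z}$, and $(a;q)_n=(1-a)(1-aq)\cdots(1-aq^{n-1})$. Little $q$-Jacobi polynomials (with base $q$): $$p_n(x;a,b\mid q)=\sum_{k=0}^{n}\frac{(q^{-n};q)_k\,(abq^{n+1};q)_k}{(aq;q)_k\,(q;q)_k}(qx)^k .$$ In $p_n(x;a,b\mid q^r)$ every $q$ in this formula is replaced by $q^r$. Orthogonality: for a field $\mathbb{K}$ and a linear functional $\varphi:\mathbb{K}[x]\to\mathbb{K}$, a sequence $(P_n(x))_{n\ge0}$ in $\mathbb{K}[x]$ with $\deg P_n=n$ is orthogonal with respect to $\varphi$ if $\varphi(P_nP_{m})=K_n\delta_{n,m}$ with $K_n\ne0$ for all $n,m\ge 0$. The functional is uniquely determined by the sequence once $\varphi(1)$ is fixed; the normalization here is $\varphi(1)=1$. Here $\mathbb{K}=\mathbb{Q}(q,Z)$. The moments are rational functions in $q$ and $Z$, and the infinite sum over $k$ is understood as an expansion as a formal power series in $Z$ with coefficients in $\mathbb{Q}(q)$. Coloured permutations: for $r,n\ge1$, $G(r,n)=\{(c_1,\dots,c_n;\sigma): c_i\in\{0,\dots,r-1\},\ \sigma\in S_n\}$, and an element is written $\gamma=[\gamma(1),\dots,\gamma(n)]=[\sigma(1)^{c_1},\dots,\sigma(n)^{c_n}]$. The possible values are totally ordered, together with the symbol $0$, by $$n^{r-1}<\dots<n^1<\dots<1^{r-1}<\dots<1^1<0<1^0<\dots<n^0 .$$ Set $\gamma(0):=0$,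 $\mathrm{Des}_G(\gamma)=\{i\in\{0,\dots,n-1\}:\gamma(i)>\gamma(i+1)\}$, $\mathrm{des}_G(\gamma)=|\mathrm{Des}_G(\gamma)|$, $\mathrm{maj}(\gamma)=\sum_{i\in\mathrm{Des}_G(\gamma)}i$, $\mathrm{col}(\gamma)=\sum_{i=1}^n c_i$, and $\mathrm{fmaj}(\gamma)=r\cdot\mathrm{maj}(\gamma)+\mathrm{col}(\gamma)$. *)

(* Defs.v *)
From HB Require Import structures.
From mathcomp Require Import all_boot all_order all_algebra all_fingroup.

Set Implicit Arguments.
Unset Strict Implicit.
Unset Printing Implicit Defensive.

Import GRing.Theory.
Local Open Scope ring_scope.

(* Q(q), and Q(q,Z) realized as Q(q)(Z). *)
Notation Qq := {fraction {poly rat}}.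
Notation QqZ := {fraction {poly Qq}}.

Definition q0 : Qq := FracField.tofrac ('X : {poly rat}).
Definition q : QqZ := FracField.tofrac (q0%:P : {poly Qq}).
Definition Z : QqZ := FracField.tofrac ('X : {poly Qq}).

Definition qint (K : fieldType) (t : K) (m : int) : K := (1 - t ^ m) / (1 - t).

Definition qpoch (K : fieldType) (a t : K) (n : nat) : K :=
  \prod_(i < n) (1 - a * t ^+ i).

(* p_n(x; a, b | t), as a polynomial in x = 'X *)
Definition little_qJacobi (K : fieldType) (a b t : K) (n : nat) : {poly K} :=
  \sum_(k < n.+1)
    (qpoch (t ^- n) t k * qpoch (a * b * t ^+ n.+1) t k
      / (qpoch (a * t) t k * qpoch t t k)) *: (t *: 'X) ^+ k.

Definition shifted_qJacobi (r : nat) (c : int) (n : nat) : {poly QqZ} :=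
  little_qJacobi (Z * q ^- r) 1 (q ^+ r) n
    \Po (q ^ (- c) *: (1 + (q - 1) *: 'X)).

Definition orthogonal_wrt (K : fieldType) (phi : {scalar {poly K}})
    (P : nat -> {poly K}) : Prop :=
  (forall n, size (P n) = n.+1) /\
  exists kappa : nat -> K,
    (forall n, kappa n != 0) /\
    (forall n m, phi (P n * P m) = if n == m then kappa n else 0).

(* Formal power series over F are represented by their coefficient sequences
   nat -> F; in particular fun k => u k stands for \sum_k (u k) Z^k. *)
Definition fps_mul (F : fieldType) (u v : nat -> F) : nat -> F :=
  fun m => \sum_(i < m.+1) u i * v (m - i)%N.

Definition fps_of_poly (F : fieldType) (p : {poly F}) : nat -> F :=
  fun m => p`_m.

(* f = N / D is regular at 0 and its Taylor series S at 0 satisfies D S = N. *)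
Definition has_expansion (F : fieldType) (f : {fraction {poly F}})
    (S : nat -> F) : Prop :=
  exists N D : {poly F},
    [/\ D`_0 != 0,
        f = FracField.tofrac N / FracField.tofrac D
      & forall m, fps_mul (fps_of_poly D) S m = fps_of_poly N m].

(* An element of G(r,n); the position i in {1..n} corresponds to i - 1 : 'I_n,
   and likewise for the values of the permutation. *)
Definition colperm (r n : nat) : finType := ({ffun 'I_n -> 'I_r} * 'S_n)%type.

(* The pair (i, c) is the symbol i^c; the extra symbol 0 is the pair (0, 0),
   which the order below puts under all the i^0, i >= 1. *)
Definition symb_lt (x y : nat * nat) : bool :=
  match x.2, y.2 with
  | 0, 0 => (x.1 < y.1)%N
  | 0, _.+1 => false
  | _.+1, 0 => true
  | _.+1, _.+1 => (y.1 < x.1)%N || ((x.1 == y.1) && (y.2 < x.2)%N)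
  end.

(* gamma(0), gamma(1), ..., gamma(n) *)
Definition word (r n : nat) (g : colperm r n) : seq (nat * nat) :=
  (0%N, 0%N) :: [seq ((g.2 i).+1, nat_of_ord (g.1 i)) | i <- enum 'I_n].

Definition letter (r n : nat) (g : colperm r n) (i : nat) : nat * nat :=
  nth (0%N, 0%N) (word g) i.

Definition DesG (r n : nat) (g : colperm r n) : {set 'I_n} :=
  [set i : 'I_n | symb_lt (letter g i.+1) (letter g i)].

Definition desG (r n : nat) (g : colperm r n) : nat := #|DesG g|.

Definition majG (r n : nat) (g : colperm r n) : nat :=
  (\sum_(i in DesG g) i)%N.

Definition colG (r n : nat) (g : colperm r n) : nat :=
  (\sum_(i < n) g.1 i)%N.

Definition fmaj (r n : nat) (g : colperm r n) : nat := (r * majG g + colG g)%N.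

Definition genpolyG (r n : nat) : QqZ :=
  \sum_(g : colperm r n) Z ^+ desG g * q ^+ fmaj g.

(* Main.v *)
(** Write [t = q^r] and let [L_z] be the linear form [x^i |-> 1 / (1 - z t^i)],
    formally [f |-> \sum_k z^k f(t^k)].

    Orthogonality: [L_z (x^m p_n)] is, up to a factor, the [n]-th [t]-difference
    at [z] of [y |-> (y; t)_n / (1 - y t^m)].  For [m < n] this is a polynomial
    of degree [< n] and is killed; for [m = n] only the polar part
    [1 / (1 - y t^n)] contributes, and its [n]-th [t]-difference is an explicit
    nonzero product.  The substitution inverse to the one defining [P_n] turns
    [x^n] into [((1 - q^c x) / (1 - q))^n], whence the moments.

    Coloured permutations: inserting the letter [(n+1)^c] in all places and
    colours gives a recurrence for the generating polynomials in which the sum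
    over the places telescopes; since [L_z ((1 - q x) f) = L_z f - q L_{zt} f],
    the products [(z; t)_{n+1} L_z (((1 - q x) / (1 - q))^n)] satisfy the same
    recurrence. *)

Require Import Defs.
From HB Require Import structures.
From mathcomp Require Import all_boot all_order all_algebra all_fingroup.
From mathcomp Require Import ring zify.

Import GRing.Theory.
Local Open Scope ring_scope.

(** * The form $L_z$ and finite $t$-products *)

(** This is $L_z$. Inverses of 0 being 0, it is a linear form for all [z] and [t]; conditions on
    them enter only when denominators are cleared. *)
Definition geom_form {K : fieldType} (z t : K) (p : {poly K}) : K :=
  \sum_(i < size p) p`_i / (1 - z * t ^+ i).

Lemma geom_form_widen {K : fieldType} (z t : K) (p : {poly K}) (n : nat) :
  (size p <= n)%N -> geom_form z t p = \sum_(i < n) p`_i / (1 - z * t ^+ i).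
Proof.
move=> le_pn; rewrite /geom_form (big_ord_widen n (fun i => p`_i / (1 - z * t ^+ i))) //.
rewrite [RHS](bigID (fun i : 'I_n => (i < size p)%N)) /=.
rewrite [X in _ + X]big1 ?addr0 // => i; rewrite -leqNgt => le_pi.
by rewrite nth_default // mul0r.
Qed.

Lemma geom_form_is_linear {K : fieldType} (z t : K) : scalar (geom_form z t).
Proof.
move=> a p1 p2; pose n := maxn (size p1) (size p2).
rewrite !(@geom_form_widen _ z t _ n) ?leq_maxl ?leq_maxr //; last first.
  rewrite (leq_trans (size_polyD _ _)) // geq_max leq_maxr andbT.
  by rewrite (leq_trans (size_scale_leq _ _)) ?leq_maxl.
rewrite mulr_sumr -big_split /=; apply: eq_bigr => i _.
by rewrite coefD coefZ mulrDl mulrA.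
Qed.

HB.instance Definition _ (K : fieldType) (z t : K) :=
  GRing.isLinear.Build K {poly K} K *%R (geom_form z t) (geom_form_is_linear z t).

Lemma geom_formXn {K : fieldType} (z t : K) (n : nat) :
  geom_form z t 'X^n = (1 - z * t ^+ n)^-1.
Proof.
rewrite (@geom_form_widen _ z t _ n.+1) ?size_polyXn //.
rewrite big_ord_recr /= coefXn eqxx mul1r big1 ?add0r // => i _.
by rewrite coefXn ltn_eqF ?mul0r.
Qed.

(** Shifting the coefficients by one place turns $z t^i$ into $z t^{i+1}$; this is the source of the
    argument $zt$ in the recurrence for coloured permutations. *)
Lemma geom_formMX {K : fieldType} (z t : K) (p : {poly K}) :
  geom_form z t (p * 'X) = geom_form (z * t) t p.
Proof.
rewrite (@geom_form_widen _ z t _ (size p).+1) ?(leq_trans (size_polyMleq _ _))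
  ?size_polyX ?addn2 //.
rewrite big_ord_recl coefMX mul0r add0r; apply: eq_bigr => i _.
by rewrite coefMX lift0 /= exprS mulrA.
Qed.

Lemma qpoch_recr {K : fieldType} (a t : K) (n : nat) :
  qpoch a t n.+1 = qpoch a t n * (1 - a * t ^+ n).
Proof. by rewrite /qpoch big_ord_recr. Qed.

Lemma qpoch0 {K : fieldType} (a t : K) : qpoch a t 0 = 1.
Proof. by rewrite /qpoch big_ord0. Qed.

Lemma qpoch_add {K : fieldType} (a t : K) (n k : nat) :
  qpoch a t (n + k) = qpoch a t n * qpoch (a * t ^+ n) t k.
Proof.
elim: k => [|k IHk]; first by rewrite addn0 qpoch0 mulr1.
by rewrite addnS !qpoch_recr IHk exprD !mulrA.
Qed.

Lemma qpoch_recl {K : fieldType} (a t : K) (n : nat) :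
  qpoch a t n.+1 = (1 - a) * qpoch (a * t) t n.
Proof. by rewrite -add1n qpoch_add qpoch_recr qpoch0 mul1r expr0 mulr1. Qed.

Lemma qpoch_neq0 {K : fieldType} (a t : K) (n : nat) :
  (forall i, (i < n)%N -> a * t ^+ i != 1) -> qpoch a t n != 0.
Proof.
by move=> at1; apply/prodf_neq0 => i _; rewrite subr_eq0 eq_sym at1.
Qed.

(** * [q]-differences and orthogonality *)

(** A signed Gaussian binomial, $(-1)^k \binom{n}{k}_t t^{k(k+1)/2-nk}$, written in the form in
    which it occurs in the coefficients of $p_n$. *)
Definition qdiff_weight {K : fieldType} (t : K) (n k : nat) : K :=
  qpoch (t ^- n) t k / qpoch t t k * t ^+ k.

(** The expanded product $\prod_{i<n} (1 - t^{-i} S)$, where $(Sf)(x) = f(xt)$; [qdiffS] splits off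
    its last factor. *)
Definition qdiff {K : fieldType} (t : K) (n : nat) (f : K -> K) (x : K) : K :=
  \sum_(k < n.+1) qdiff_weight t n k * f (x * t ^+ k).

Section QDifference.
Context {K : fieldType} (t : K).
Hypothesis t_neq0 : t != 0.
Hypothesis t_neq1 : forall i, t ^+ i.+1 != 1.

Let tn_neq0 n : t ^+ n != 0. Proof. by rewrite expf_neq0. Qed.
Let tS_neq0 n : 1 - t ^+ n.+1 != 0. Proof. by rewrite subr_eq0 eq_sym. Qed.

Lemma qpoch_tt_neq0 n : qpoch t t n != 0.
Proof. by apply: qpoch_neq0 => i _; rewrite -exprS. Qed.

Lemma qpochV_neq0 n : qpoch (t ^- n) t n != 0.
Proof.
apply: qpoch_neq0 => i lt_in; apply: contra (t_neq1 (n - i.+1)) => /eqP e.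
rewrite subnSK //; apply/eqP; apply: (mulfI (tn_neq0 i)).
by rewrite -exprD subnKC 1?ltnW // mulr1 -[LHS]mulr1 -e mulVKf.
Qed.

Lemma qdiff_weight0 n : qdiff_weight t n 0 = 1.
Proof. by rewrite /qdiff_weight !qpoch0 expr0 divr1 mulr1. Qed.

(** Pascal's rule for Gaussian binomials in this normalization. *)
Lemma qdiff_weightS n k :
  qdiff_weight t n.+1 k.+1 = qdiff_weight t n k.+1 - t ^- n * qdiff_weight t n k.
Proof.
rewrite /qdiff_weight [qpoch (_ ^- n.+1) _ _]qpoch_recl !qpoch_recr.
have -> : t ^- n.+1 * t = t ^- n by rewrite exprS invfM mulrAC mulVf ?mul1r.
have := qpoch_tt_neq0 k; have := tS_neq0 k; have := tn_neq0 n.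
rewrite !exprS.
move: (t ^+ n) (t ^+ k) (qpoch t t k) (qpoch _ t k) => a b c d a0 b0 c0.
field. by rewrite a0 b0 c0 t_neq0.
Qed.

Lemma qdiff_weight_gt n : qdiff_weight t n n.+1 = 0.
Proof.
by rewrite /qdiff_weight qpoch_recr mulVf // subrr mulr0 !mul0r.
Qed.

Lemma qdiffS n (f : K -> K) x :
  qdiff t n.+1 f x = qdiff t n f x - t ^- n * qdiff t n f (x * t).
Proof.
rewrite /qdiff big_ord_recl /= qdiff_weight0.
under eq_bigr => i _ do rewrite /bump /= add1n qdiff_weightS mulrBl exprS
  [x * (t * _)]mulrA -[t ^- n * _ * _]mulrA.
rewrite sumrB -mulr_sumr addrA; congr (_ - _).
(* Pascal's rule leaves a term of index $n+1$, whose weight vanishes. *)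
rewrite big_ord_recr /= qdiff_weight_gt mul0r addr0 [RHS]big_ord_recl qdiff_weight0.
by congr (_ + _); apply: eq_bigr => i _; rewrite lift0 exprS mulrA.
Qed.

Lemma qdiff0 (f : K -> K) x : qdiff t 0 f x = f x.
Proof. by rewrite /qdiff big_ord1 qdiff_weight0 expr0 mulr1 mul1r. Qed.

Lemma qdiffXn n j x : (j < n)%N -> qdiff t n (fun y => y ^+ j) x = 0.
Proof.
move=> lt_jn.
(* $y^j$ is an eigenvector of $S$ with eigenvalue $t^j$, so each factor $1 - t^{-i} S$ acts as a
   scalar; the one with $i = j$ is zero. *)
suff -> : qdiff t n (fun y => y ^+ j) x = \prod_(i < n) (1 - t ^+ j / t ^+ i) * x ^+ j.
  by rewrite (bigD1 (Ordinal lt_jn)) //= divff // subrr !mul0r.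
elim: {lt_jn} n x => [|n IHn] x; first by rewrite qdiff0 big_ord0 mul1r.
rewrite qdiffS !IHn big_ord_recr /= exprMn; ring.
Qed.

Lemma qdiffZ n a (f : K -> K) x :
  qdiff t n (fun y => a * f y) x = a * qdiff t n f x.
Proof. by rewrite mulr_sumr; apply: eq_bigr => i _; rewrite mulrCA. Qed.

Lemma qdiff_poly n (p : {poly K}) x :
  (size p <= n)%N -> qdiff t n (fun y => p.[y]) x = 0.
Proof.
move=> le_pn; rewrite /qdiff.
under eq_bigr => k _ do rewrite (horner_coef_wide _ le_pn) mulr_sumr.
rewrite exchange_big big1 //= => j _.
under eq_bigr => k _ do rewrite mulrCA.
by rewrite -mulr_sumr -/(qdiff t n (fun y => y ^+ j) x) qdiffXn ?mulr0.
Qed.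

(** In the induction $t^{-n}$ cancels against $(xt)^n$, and over the common denominator
    $(x;t)_{n+2}$ the numerator is $(1 - xt^{n+1}) - (1 - x) = x(1 - t^{n+1})$. *)
Lemma qdiff_geom n x : (forall i, x * t ^+ i != 1) ->
  qdiff t n (fun y => (1 - y)^-1) x = qpoch t t n * x ^+ n / qpoch x t n.+1.
Proof.
elim: n x => [|n IHn] x x_neq1.
  by rewrite qdiff0 qpoch_recr !qpoch0 !expr0 !mul1r mulr1.
have xt_neq1 i : x * t * t ^+ i != 1 by rewrite -mulrA -exprS.
rewrite qdiffS !IHn // exprMn [qpoch x t n.+2]qpoch_recl [qpoch x t n.+1]qpoch_recl.
rewrite [qpoch (x * t) t n.+1]qpoch_recr [qpoch t t n.+1]qpoch_recr.
have h1 : 1 - x != 0 by rewrite subr_eq0 eq_sym -[x]mulr1 -(expr0 t).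
have h2 : 1 - x * t * t ^+ n != 0 by rewrite subr_eq0 eq_sym.
have h3 : qpoch (x * t) t n != 0 by apply: qpoch_neq0.
have := tn_neq0 n; move: h2 h3; rewrite exprS.
move: (qpoch (x * t) t n) (qpoch t t n) (t ^+ n) (x ^+ n) => a b c d h2 h3 h4.
by field; rewrite h1 h2 h3 h4.
Qed.

(* After division by [1 - y t^m] the numerator is a polynomial of degree
   [n - 1], which [qdiff t n] kills. *)
Lemma qdiff_qpoch_lt n m x : (forall i, x * t ^+ i != 1) -> (m < n)%N ->
  qdiff t n (fun y => qpoch y t n / (1 - y * t ^+ m)) x = 0.
Proof.
move=> x_neq1 lt_mn.
pose g : {poly K} := \prod_(i < n | i != Ordinal lt_mn) (1 - t ^+ i *: 'X).
have size_g : (size g <= n)%N.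
  apply: (leq_trans (size_prod_leq _ _)).
  rewrite leq_subLR cardC1 card_ord.
  rewrite (@leq_trans (\sum_(i < n | i != Ordinal lt_mn) 2).+1) //.
    rewrite ltnS leq_sum // => i _.
    by rewrite (leq_trans (size_polyD _ _)) // size_poly1 size_polyN geq_max
               (leq_trans (size_scale_leq _ _)) ?size_polyX.
  rewrite sum_nat_const cardC1 card_ord muln2 -addnn -addnS prednK //.
  exact: leq_ltn_trans (leq0n m) lt_mn.
rewrite -[RHS](qdiff_poly _ _ x size_g).
apply: eq_bigr => k _; congr (_ * _).
rewrite /qpoch (bigD1 (Ordinal lt_mn)) //= mulrC mulKf; last first.
  by rewrite subr_eq0 eq_sym -mulrA -exprD.
rewrite horner_prod; apply: eq_bigr => i _.
by rewrite hornerD hornerN hornerZ hornerX hornerC [t ^+ i * _]mulrC.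
Qed.

(* Dividing with remainder by [1 - y t^n], only the remainder, which is the
   value of the numerator at [y = t^-n], contributes. *)
Lemma qdiff_qpoch_eq n x : (forall i, x * t ^+ i != 1) ->
  qdiff t n (fun y => qpoch y t n / (1 - y * t ^+ n)) x =
  qpoch (t ^- n) t n *
    (qpoch t t n * (x * t ^+ n) ^+ n / qpoch (x * t ^+ n) t n.+1).
Proof.
move=> x_neq1.
pose h : {poly K} := \prod_(i < n) (1 - t ^+ i *: 'X).
have hE y : h.[y] = qpoch y t n.
  rewrite horner_prod; apply: eq_bigr => i _.
  by rewrite hornerD hornerN hornerZ hornerX hornerC [t ^+ i * _]mulrC.
have size_h : (size h <= n.+1)%N.
  apply: (leq_trans (size_prod_leq _ _)); rewrite leq_subLR card_ord.
  rewrite (@leq_trans (\sum_(i < n) 2).+1) //.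
    rewrite ltnS leq_sum // => i _.
    by rewrite (leq_trans (size_polyD _ _)) // size_poly1 size_polyN geq_max
               (leq_trans (size_scale_leq _ _)) ?size_polyX.
  by rewrite sum_nat_const card_ord muln2 -addnn addnS.
have /factor_theorem[g gE] : root (h - (h.[t ^- n])%:P) (t ^- n).
  by rewrite /root hornerD hornerN hornerC subrr.
have size_g : (size g <= n)%N.
  have [->|g0] := eqVneq g 0; first by rewrite size_poly0.
  have := size_polyD h (- (h.[t ^- n])%:P); rewrite gE size_Mmonic ?monicXsubC //.
  rewrite size_XsubC addn2 /= size_polyN => /leq_trans H.
  by rewrite -ltnS; apply: H; rewrite geq_max size_h (leq_trans (size_polyC_leq1 _)).
have tx_neq1 i : x * t ^+ n * t ^+ i != 1 by rewrite -mulrA -exprD.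
(* As $(y - t^{-n})/(1 - y t^n) = -t^{-n}$, this is the polynomial part of the quotient. *)
have g_killed : qdiff t n (fun y => - t ^- n * g.[y]) x = 0.
  by rewrite qdiffZ qdiff_poly ?mulr0.
rewrite -qdiff_geom // -qdiffZ -[RHS]addr0 -[X in _ = _ + X]g_killed -big_split /=.
apply: eq_bigr => k _; rewrite -mulrDr; congr (_ * _).
have e : x * t ^+ n * t ^+ k = x * t ^+ k * t ^+ n by rewrite mulrAC.
have := tx_neq1 k; rewrite e; move: (x * t ^+ k) => y y_neq1.
have := congr1 (horner^~ y) gE; rewrite /= hornerM !hornerD !hornerN !hornerC hornerX.
rewrite !hE => /eqP; rewrite subr_eq => /eqP ->.
have : 1 - y * t ^+ n != 0 by rewrite subr_eq0 eq_sym.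
have := tn_neq0 n.
move: (t ^+ n) (g.[y]) => a b a0 ya.
by field; rewrite a0 ya.
Qed.

End QDifference.

(** * Orthogonality of the little $q$-Jacobi polynomials with $aq = z$, $b = 1$ *)

Section LittleQJacobi.
Context {K : fieldType} (t z : K).
Hypothesis t_neq0 : t != 0.
Hypothesis t_neq1 : forall i, t ^+ i.+1 != 1.
Hypothesis z_neq0 : z != 0.
Hypothesis zt_neq1 : forall i, z * t ^+ i != 1.

Let p n := little_qJacobi (z / t) 1 t n.

(** The ratio $(zt^n;t)_k/(z;t)_k$ in the coefficients equals $(zt^k;t)_n/(z;t)_n$, whose numerator
    is $(y;t)_n$ at the node $y = zt^k$; $L_z(x^{m+k})$ supplies $1/(1 - yt^m)$ there. *)
Lemma geom_form_little_qJacobi m n :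
  geom_form z t ('X^m * p n) =
  qdiff t n (fun y => qpoch y t n / (1 - y * t ^+ m)) z / qpoch z t n.
Proof.
rewrite /p /little_qJacobi mulr_sumr linear_sum mulr_suml /=.
apply: eq_bigr => k _.
rewrite -mulrA.
have -> : z / t * 1 * t ^+ n.+1 = z * t ^+ n by rewrite mulr1 exprS mulrA mulfVK.
rewrite mulfVK // exprZn -!scalerAr -exprD !linearZ /= geom_formXn.
have h1 : qpoch z t n != 0 by apply: qpoch_neq0.
have h2 : qpoch z t k != 0 by apply: qpoch_neq0.
have h3 := qpoch_tt_neq0 t t_neq1 k.
have e : qpoch z t n * qpoch (z * t ^+ n) t k = qpoch z t k * qpoch (z * t ^+ k) t n.
  by rewrite -!qpoch_add addnC.
rewrite -(mulKf h1 (qpoch (z * t ^+ n) t k)) e exprD /qdiff_weight.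
have -> : z * (t ^+ m * t ^+ k) = z * t ^+ k * t ^+ m by rewrite mulrAC mulrA.
have h4 : 1 - z * t ^+ k * t ^+ m != 0 by rewrite subr_eq0 eq_sym -mulrA -exprD.
move: h1 h2 h3 h4.
move: (t ^+ k) (t ^+ m) (qpoch z t n) (qpoch z t k) (qpoch t t k) (qpoch (t ^- n) t k).
move=> tk tm a b c d h1 h2 h3 h4; field.
by rewrite h1 h2 h3 h4.
Qed.

Lemma coef_little_qJacobi n k : (p n)`_k =
  if (k <= n)%N then
    qpoch (t ^- n) t k * qpoch (z * t ^+ n) t k / (qpoch z t k * qpoch t t k) * t ^+ k
  else 0.
Proof.
rewrite /p /little_qJacobi coef_sum.
have -> : z / t * 1 * t ^+ n.+1 = z * t ^+ n by rewrite mulr1 exprS mulrA mulfVK.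
rewrite mulfVK //.
case: leqP => [le_kn|lt_nk].
  rewrite (bigD1 (Ordinal (leq_ltn_trans le_kn (ltnSn n)))) //= big1 ?addr0.
    by rewrite exprZn !coefZ coefXn eqxx mulr1.
  move=> i ne_ik; rewrite exprZn !coefZ coefXn.
  case: eqP => [e|_]; last by rewrite !mulr0.
  by move: ne_ik; rewrite -val_eqE /= e eqxx.
rewrite big1 // => i _; rewrite exprZn !coefZ coefXn gtn_eqF ?mulr0 //.
exact: leq_ltn_trans (leq_ord i) lt_nk.
Qed.

Lemma little_qJacobi_lead n : (p n)`_n != 0.
Proof.
rewrite coef_little_qJacobi leqnn !mulf_neq0 ?qpochV_neq0 ?invr_neq0 ?expf_neq0 //.
  by apply: qpoch_neq0 => i _; rewrite -mulrA -exprD.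
by rewrite mulf_neq0 ?qpoch_tt_neq0 // qpoch_neq0.
Qed.

Lemma size_little_qJacobi n : size (p n) = n.+1.
Proof.
apply/eqP; rewrite eqn_leq; apply/andP; split.
  by apply/leq_sizeP => j lt_nj; rewrite coef_little_qJacobi leqNgt lt_nj.
rewrite ltnNge; apply: contra (little_qJacobi_lead n) => /leq_sizeP -> //.
Qed.

Lemma geom_form_little_qJacobi_lt n (f : {poly K}) :
  (size f <= n)%N -> geom_form z t (f * p n) = 0.
Proof.
move=> le_fn; rewrite -[f]coefK poly_def mulr_suml linear_sum /= big1 // => i _.
rewrite -scalerAl linearZ /= geom_form_little_qJacobi qdiff_qpoch_lt ?mul0r ?mulr0 //.
exact: leq_trans le_fn.
Qed.

(** One factor can be replaced by its leading term, since the rest has lower degree and is killed;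
    [qdiff_qpoch_eq] then gives a product of nonzero factors. *)
Lemma geom_form_little_qJacobi_neq0 n : geom_form z t (p n * p n) != 0.
Proof.
rewrite -{1}(subrK ((p n)`_n *: 'X^n) (p n)) addrC mulrDl linearD /=.
rewrite [X in _ + X]geom_form_little_qJacobi_lt ?addr0; last first.
  apply/leq_sizeP => j; rewrite leq_eqVlt coefB coefZ coefXn => /orP[/eqP<-|lt_nj].
    by rewrite eqxx mulr1 subrr.
  by rewrite gtn_eqF // mulr0 subr0 coef_little_qJacobi leqNgt lt_nj.
rewrite -scalerAl linearZ /= geom_form_little_qJacobi qdiff_qpoch_eq //.
rewrite !mulf_neq0 ?little_qJacobi_lead ?qpochV_neq0 ?qpoch_tt_neq0 ?invr_neq0 ?expf_neq0
  ?mulf_neq0 ?expf_neq0 ?qpoch_neq0 // => i _; by rewrite -mulrA -exprD.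
Qed.

(** Transport along an affine substitution: $(p \circ s) \circ s' = p$, so [phi (P n * P m)] is $a
    L_z(p_n p_m)$. *)
Lemma orthogonal_little_qJacobi (phi : {scalar {poly K}}) (P : nat -> {poly K})
    (s s' : {poly K}) (a : K) :
  a != 0 -> size s = 2 -> s \Po s' = 'X ->
  (forall f, phi f = a * geom_form z t (f \Po s')) ->
  (forall n, P n = p n \Po s) -> orthogonal_wrt phi P.
Proof.
move=> a0 size_s ss' phiE PE; split=> [n|].
  by rewrite PE size_comp_poly2 // size_little_qJacobi.
exists (fun n => a * geom_form z t (p n * p n)); split=> [n|n m].
  by rewrite mulf_neq0 ?geom_form_little_qJacobi_neq0.
rewrite !PE phiE -comp_polyM -comp_polyA ss' comp_polyXr.
have [->//|] := eqVneq n m.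
rewrite neq_ltn => /orP[] h; last rewrite [p n * _]mulrC.
all: by rewrite geom_form_little_qJacobi_lt ?mulr0 // size_little_qJacobi.
Qed.

End LittleQJacobi.

(** * Uniqueness of the orthogonality functional *)

(** Orthogonality to the nonzero constant $P_0$ forces the value 0 on every $P_{n+1}$, so both forms
    agree on all $P_n$; subtracting multiples of $P_n$ lowers the degree of [f]. *)
Lemma orthogonal_form_unique {K : fieldType} (P : nat -> {poly K})
    (phi psi : {scalar {poly K}}) :
  orthogonal_wrt phi P -> orthogonal_wrt psi P -> phi 1 = 1 -> psi 1 = 1 ->
  forall f, phi f = psi f.
Proof.
move=> [sizeP [ka [_ phiP]]] [_ [kb [_ psiP]]] phi1 psi1.
have P0 : P 0 = ((P 0)`_0)%:P by apply: size1_polyC; rewrite sizeP.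
have P00 : (P 0)`_0 != 0.
  by rewrite -polyC_eq0 -P0 -size_poly_eq0 sizeP.
have vanish (th : {scalar {poly K}}) kc n :
  (forall n m, th (P n * P m) = if n == m then kc n else 0) -> th (P n.+1) = 0.
  move=> /(_ n.+1 0%N) /=; rewrite P0 mulrC mul_polyC linearZ /= => /eqP.
  by rewrite mulf_eq0 (negPf P00) => /eqP.
have phi_psi n : phi (P n) = psi (P n).
  case: n => [|n]; last by rewrite (vanish _ _ _ phiP) (vanish _ _ _ psiP).
  by rewrite P0 -[_%:P]mulr1 mul_polyC !linearZ /= phi1 psi1.
move=> f; have [n] := ubnP (size f); elim: n f => // n IHn f; rewrite ltnS => le_fn.
case: n IHn le_fn => [_|n IHn le_fn].
  by rewrite leqn0 size_poly_eq0 => /eqP->; rewrite !linear0.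
have lP : (P n)`_n != 0.
  by have := sizeP n; move/(congr1 predn) => /= e; rewrite -[n in _`_n]e -lead_coefE
     lead_coef_eq0 -size_poly_eq0 sizeP.
pose c := f`_n / (P n)`_n.
have size_g : (size (f - c *: P n)%R < n.+1)%N.
  rewrite ltnS; apply/leq_sizeP => j; rewrite leq_eqVlt coefB coefZ.
  case/orP => [/eqP<-|lt_nj]; first by rewrite /c divfK // subrr.
  by rewrite !nth_default ?mulr0 ?subr0 ?sizeP // (leq_trans le_fn).
rewrite -(subrK (c *: P n) f); move: (f - _) size_g => g size_g.
by rewrite !linearD !linearZ /= phi_psi IHn.
Qed.

Lemma eq_orthogonal_wrt {K : fieldType} (phi : {scalar {poly K}})
    (P P' : nat -> {poly K}) :
  P =1 P' -> orthogonal_wrt phi P -> orthogonal_wrt phi P'.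
Proof.
move=> eP [sizeP [kappa [k0 phiP]]]; split=> [n|]; first by rewrite -eP.
by exists kappa; split=> // n m; rewrite -!eP.
Qed.

(** * Expansions at the origin *)

(** Truncation lets the Cauchy product inherit associativity from polynomials. *)
Lemma fps_mul_trunc {F : fieldType} (u v : nat -> F) (M m : nat) : (m < M)%N ->
  fps_mul u v m = ((\poly_(i < M) u i) * (\poly_(i < M) v i))`_m.
Proof.
move=> lt_mM; rewrite coefM; apply: eq_bigr => i _.
by rewrite !coef_poly !(leq_ltn_trans _ lt_mM) ?leq_subr ?leq_ord.
Qed.

Lemma fps_of_polyM {F : fieldType} (p1 p2 : {poly F}) (m : nat) :
  fps_mul (fps_of_poly p1) (fps_of_poly p2) m = fps_of_poly (p1 * p2) m.
Proof. by rewrite /fps_of_poly coefM. Qed.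

Lemma eq_fps_mul {F : fieldType} (u u' v v' : nat -> F) :
  u =1 u' -> v =1 v' -> fps_mul u v =1 fps_mul u' v'.
Proof. by move=> eu ev m; apply: eq_bigr => i _; rewrite eu ev. Qed.

Lemma fps_mulA {F : fieldType} (u v w : nat -> F) :
  fps_mul u (fps_mul v w) =1 fps_mul (fps_mul u v) w.
Proof.
move=> m.
transitivity (((\poly_(i < m.+1) u i) * ((\poly_(i < m.+1) v i) *
   (\poly_(i < m.+1) w i)))`_m).
  rewrite coefM; apply: eq_bigr => i _.
  by rewrite coef_poly ltn_ord (@fps_mul_trunc _ _ _ m.+1) // ltnS leq_subr.
rewrite mulrA coefM; apply: eq_bigr => i _.
by rewrite coef_poly ltnS leq_subr (@fps_mul_trunc _ u v m.+1).
Qed.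

Lemma fps_mul_polyM {F : fieldType} (p1 p2 : {poly F}) (S : nat -> F) :
  fps_mul (fps_of_poly (p1 * p2)) S =1
  fps_mul (fps_of_poly p1) (fps_mul (fps_of_poly p2) S).
Proof.
by move=> m; rewrite fps_mulA; apply: eq_fps_mul => // i; rewrite fps_of_polyM.
Qed.

Lemma fps_mulDr {F : fieldType} (u v w : nat -> F) :
  fps_mul u (fun m => v m + w m) =1 (fun m => fps_mul u v m + fps_mul u w m).
Proof. by move=> m; rewrite -big_split; apply: eq_bigr => i _; rewrite mulrDr. Qed.

Section Expansion.
Context {F : fieldType}.
Implicit Types (f g : {fraction {poly F}}) (S T : nat -> F) (p : {poly F}).

Lemma eq_has_expansion f S T : S =1 T -> has_expansion f S -> has_expansion f T.
Proof.
move=> eST [N [D [D0 fE DS]]]; exists N, D; split=> // m.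
by rewrite -DS; apply: eq_fps_mul.
Qed.

Lemma has_expansionD f g S T : has_expansion f S -> has_expansion g T ->
  has_expansion (f + g) (fun m => S m + T m).
Proof.
move=> [N1 [D1 [D10 -> DS]]] [N2 [D2 [D20 -> DT]]].
have nz (D : {poly F}) : D`_0 != 0 -> FracField.tofrac D != 0.
  by move=> h; rewrite tofrac_eq0; apply: contra h => /eqP->; rewrite coef0.
exists (N1 * D2 + N2 * D1), (D1 * D2); split.
- by rewrite coef0M mulf_neq0.
- by rewrite tofracD !tofracM addf_div ?nz.
move=> m; rewrite fps_mulDr [RHS]/fps_of_poly coefD; congr (_ + _).
- rewrite mulrC fps_mul_polyM -[RHS]/(fps_of_poly (N1 * D2) m) mulrC -fps_of_polyM.
  exact: eq_fps_mul.
- rewrite fps_mul_polyM -[RHS]/(fps_of_poly (N2 * D1) m) mulrC -fps_of_polyM.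
  exact: eq_fps_mul.
Qed.

Lemma has_expansionM f S p : has_expansion f S ->
  has_expansion (FracField.tofrac p * f) (fps_mul (fps_of_poly p) S).
Proof.
move=> [N [D [D0 -> DS]]]; exists (p * N), D; split=> //.
  by rewrite tofracM mulrA.
move=> m; rewrite -fps_of_polyM -(eq_fps_mul _ _ _ _ (frefl _) DS).
by rewrite -!fps_mul_polyM mulrC.
Qed.

Lemma has_expansionZ f S (a : F) : has_expansion f S ->
  has_expansion (FracField.tofrac a%:P * f) (fun m => a * S m).
Proof.
move=> /(has_expansionM _ _ a%:P); apply: eq_has_expansion => m.
rewrite /fps_mul big_ord_recl /fps_of_poly /= subn0 coefC /= big1 ?addr0 // => i _.
by rewrite coefC mul0r.
Qed.

Lemma has_expansion0 : has_expansion (0 : {fraction {poly F}}) (fun=> 0).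
Proof.
exists 0, 1; split; rewrite ?coef1 ?oner_neq0 ?tofrac0 ?mul0r //.
by move=> m; rewrite /fps_of_poly coef0 /fps_mul big1 // => i _; rewrite mulr0.
Qed.

Lemma has_expansion_geom (s : F) :
  has_expansion (1 - FracField.tofrac 'X * FracField.tofrac s%:P)^-1 (fun k => s ^+ k).
Proof.
exists 1, (1 - s *: 'X); split.
- by rewrite coefB coef1 coefZ coefX mulr0 subr0 oner_neq0.
- by rewrite tofracB tofrac1 -mul_polyC tofracM mul1r [X in 1 - X]mulrC.
case=> [|m]; rewrite /fps_mul /fps_of_poly.
  by rewrite big_ord1 coefB coef1 coefZ coefX mulr0 subr0 mul1r.
rewrite !big_ord_recl big1 ?addr0 => [|i _]; last first.
  by rewrite !lift0 coefB coef1 coefZ coefX mulr0 subr0 mul0r.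
rewrite !coefB !coef1 !coefZ !coefX /= mulr0 subr0 mul1r subn0 /bump /= subn1 /=.
by rewrite sub0r mulr1 exprS mulNr subrr.
Qed.

(** This makes the formal reading of $L_z$ rigorous: expanding each $1/(1 - Zs^i)$ gives the $k$-th
    coefficient $\sum_i p_i s^{ik} = p(s^k)$. *)
Lemma has_expansion_geom_form (s : F) p :
  has_expansion
    (geom_form (FracField.tofrac 'X) (FracField.tofrac s%:P)
       (map_poly (@FracField.tofrac {poly F} \o polyC) p))
    (fun k => p.[s ^+ k]).
Proof.
rewrite (@geom_form_widen _ _ _ _ (size p)) ?size_poly //.
suff H n : (n <= size p)%N -> has_expansion
    (\sum_(i < n) (map_poly (@FracField.tofrac {poly F} \o polyC) p)`_i /
       (1 - FracField.tofrac 'X * FracField.tofrac s%:P ^+ i))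
    (fun k => \sum_(i < n) p`_i * (s ^+ k) ^+ i).
  by apply: eq_has_expansion (H _ (leqnn _)) => k; rewrite horner_coef.
elim: n => [|n IHn] le_np.
  rewrite big_ord0; apply: eq_has_expansion has_expansion0 => k.
  by rewrite big_ord0.
rewrite big_ord_recr /= coef_poly le_np.
have := has_expansionD _ _ _ _ (IHn (ltnW le_np))
  (has_expansionZ _ _ p`_n (has_expansion_geom (s ^+ n))).
rewrite [(s ^+ n)%:P]rmorphXn [FracField.tofrac (_ ^+ n)]rmorphXn.
apply: eq_has_expansion => k.
by rewrite big_ord_recr /= -!exprM mulnC.
Qed.

End Expansion.

(** * Insertion of the largest letter in a coloured permutation *)

(** Positions are plain numbers here, so that sums over them can be cut and shifted. *)
Definition descent {r n : nat} (g : colperm r n) (j : nat) : bool :=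
  symb_lt (letter g j.+1) (letter g j).

Lemma desG_sum {r n : nat} (g : colperm r n) :
  desG g = (\sum_(0 <= j < n) descent g j)%N.
Proof.
rewrite big_mkord /desG -sum1_card big_mkcond; apply: eq_bigr => i _.
by rewrite inE -/(descent g i); case: descent.
Qed.

Lemma majG_sum {r n : nat} (g : colperm r n) :
  majG g = (\sum_(0 <= j < n) j * descent g j)%N.
Proof.
rewrite big_mkord /majG big_mkcond; apply: eq_bigr => i _.
by rewrite inE -/(descent g i); case: descent; rewrite ?muln1 ?muln0.
Qed.

Lemma letterS {r n : nat} (g : colperm r n) (i : 'I_n) :
  letter g i.+1 = ((g.2 i).+1, nat_of_ord (g.1 i)).
Proof. by rewrite /letter /= (nth_map i) ?size_enum_ord // nth_ord_enum. Qed.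

Lemma letter_le {r n : nat} (g : colperm r n) (j : nat) :
  ((letter g j).1 <= n)%N.
Proof.
have [le_nj|lt_jn] := leqP n.+1 j.
  by rewrite /letter nth_default //= size_map size_enum_ord.
case: j lt_jn => // j; rewrite ltnS => lt_jn.
by rewrite (letterS g (Ordinal lt_jn)) /=.
Qed.

(** The letter $(n+1)^c$ goes right after $\gamma(i)$, hence to position $i+1$; the slot $i = 0$
    follows the conventional $\gamma(0) = 0$. *)
Definition insert_max {r n : nat} (i : 'I_n.+1) (c : 'I_r) (g : colperm r n) :
    colperm r n.+1 :=
  ([ffun j => if unlift i j is Some k then g.1 k else c],
   lift_perm i ord_max g.2).

Lemma letter_insert_max {r n : nat} (i : 'I_n.+1) (c : 'I_r) (g : colperm r n) j :
  (j <= n.+1)%N ->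
  letter (insert_max i c g) j =
  if (j <= i)%N then letter g j
  else if j == i.+1 then (n.+1, nat_of_ord c) else letter g j.-1.
Proof.
case: j => [//|j] lt_jn; rewrite (_ : j = Ordinal lt_jn) //.
move: (Ordinal lt_jn) => {j lt_jn} o; rewrite letterS /= ffunE.
case: unliftP => [k|] ->; last by rewrite ltnn eqxx lift_perm_id.
rewrite lift_perm_lift lift_max /= /bump; case: (leqP i k) => h.
  by rewrite add1n ltnNge leqW //= eqSS gtn_eqF ?ltnS //= letterS.
by rewrite add0n h letterS.
Qed.

(** In the order on symbols, $(n+1)^c$ lies below all smaller values and 0 when $c > 0$, and above
    them when $c = 0$. *)
Lemma symb_lt_maxl n c x : (x.1 <= n)%N -> symb_lt (n.+1, c) x = (0 < c)%N.
Proof. by case: x c => [a [|b]] [|c] //= h; rewrite /symb_lt /=; lia. Qed.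

Lemma symb_lt_maxr n c x : (x.1 <= n)%N -> symb_lt x (n.+1, c) = (c == 0)%N.
Proof. by case: x c => [a [|b]] [|c] //= h; rewrite /symb_lt /=; lia. Qed.

Lemma descent_insert_max {r n : nat} (i : 'I_n.+1) (c : 'I_r) (g : colperm r n) j :
  (j <= n)%N ->
  descent (insert_max i c g) j =
  if (j < i)%N then descent g j
  else if j == i then (0 < c)%N
  else if j == i.+1 then (c == 0 :> nat)%N else descent g j.-1.
Proof.
move=> le_jn; rewrite /descent !letter_insert_max //; last exact: leqW.
have le_in := leq_ord i.
case: (ltngtP j i) => [lt_ji|lt_ij|->] //.
- rewrite gtn_eqF ?eqSS //=; case: eqP => [->|/eqP ne].
    by rewrite symb_lt_maxr ?letter_le.
  by case: j lt_ij {le_jn ne}.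
- by rewrite eqxx symb_lt_maxl ?letter_le.
Qed.

(** The weight [w] treats [desG] ($w = 1$) and [majG] ($w_j = j$) together. The pair at $i$ is
    separated, so its descent drops out of the sum; in the last slot no letter follows the new
    one. *)
Lemma sum_descent_insert_max {r n : nat} (w : nat -> nat) (i : 'I_n.+1) (c : 'I_r)
    (g : colperm r n) :
  (\sum_(0 <= j < n.+1) w j * descent (insert_max i c g) j =
   \sum_(0 <= j < i) w j * descent g j + w i * (0 < c) +
   if (i < n)%N then w i.+1 * (c == 0 :> nat) +
      \sum_(i.+1 <= j < n) w j.+1 * descent g j else 0)%N.
Proof.
have le_in := leq_ord i.
rewrite (@big_cat_nat _ _ _ i) //=; last exact: leqW.
rewrite -addnA; congr (_ + _)%N.
  apply: eq_big_nat => j /andP[_ lt_ji]; rewrite descent_insert_max ?lt_ji //.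
  exact: leq_trans (ltnW lt_ji) le_in.
rewrite big_ltn ?ltnS // descent_insert_max // ltnn eqxx; congr (_ + _)%N.
rewrite big_add1 /=; case: (ltnP i n) => [lt_in|le_ni]; last by rewrite big_geq.
rewrite big_ltn // descent_insert_max // ltnNge leqnSn /= gtn_eqF // eqxx.
congr (_ + _)%N; apply: eq_big_nat => j /andP[lt_ij lt_jn].
rewrite descent_insert_max // ltnNge leqW ?(ltnW lt_ij) //= !gtn_eqF //.
exact: leqW.
Qed.

Lemma colG_insert_max {r n : nat} (i : 'I_n.+1) (c : 'I_r) (g : colperm r n) :
  colG (insert_max i c g) = (c + colG g)%N.
Proof.
rewrite /colG (bigD1_ord i) //= ffunE unlift_none; congr (_ + _)%N.
by apply: eq_bigr => k _; rewrite ffunE liftK.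
Qed.

(** The slot is recovered as the place of the largest value, the rest by deleting it; injectivity
    suffices because $(n+1) r \cdot r^n n! = r^{n+1} (n+1)!$. *)
Lemma insert_max_bij (r n : nat) :
  bijective (fun x : 'I_n.+1 * 'I_r * colperm r n => insert_max x.1.1 x.1.2 x.2).
Proof.
apply: inj_card_bij; last first.
  rewrite !card_prod !card_ffun !card_ord !card_Sn expnS factS; lia.
move=> [[i c] [f s]] [[i' c'] [f' s']] /= [/ffunP ef es].
have ei : i = i'.
  by apply: (@perm_inj _ (lift_perm i' ord_max s')); rewrite -{1}es !lift_perm_id.
rewrite -{i'}ei in ef es *.
have -> : c = c' by have := ef i; rewrite !ffunE unlift_none.
have -> : f = f'.
  by apply/ffunP => k; have := ef (lift i k); rewrite !ffunE liftK.
suff -> : s = s' by [].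
apply/permP => k; apply: (@lift_inj _ ord_max).
by rewrite -!(lift_perm_lift i) es.
Qed.

Definition descents_from {r n : nat} (g : colperm r n) (i : nat) : nat :=
  (\sum_(i <= j < n) descent g j)%N.

Lemma desG_insert_max {r n : nat} (i : 'I_n.+1) (c : 'I_r) (g : colperm r n) :
  desG (insert_max i c g) =
  (desG g + if (i < n)%N then ~~ descent g i : nat else 0 < c)%N.
Proof.
have le_in := leq_ord i.
have := sum_descent_insert_max (fun=> 1%N) i c g.
under eq_bigr => j _ do rewrite mul1n.
under [X in _ = (X + _ + _)%N -> _]eq_bigr => j _ do rewrite mul1n.
under [X in _ = (_ + if _ then _ + X else _)%N -> _]eq_bigr => j _ do rewrite mul1n.
rewrite !desG_sum => ->; rewrite (@big_cat_nat _ _ _ i 0 n) //=.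
case: (ltnP i n) => [lt_in|le_ni]; last by rewrite (@big_geq _ _ _ i n) //; lia.
by rewrite [in RHS](big_ltn lt_in); case: (descent g i) (c : nat) => [] [] /=; lia.
Qed.

(** In an inner slot, the descents beyond it move one place to the right, and the new descent, at
    $i$ or $i+1$ according to the colour, replaces the one at $i$ if there was one. *)
Lemma majG_insert_max {r n : nat} (i : 'I_n.+1) (c : 'I_r) (g : colperm r n) :
  majG (insert_max i c g) =
  (majG g + if (i < n)%N then
     descents_from g i.+1 + (c == 0 :> nat) + ~~ descent g i * i else (0 < c) * n)%N.
Proof.
have le_in := leq_ord i.
rewrite !majG_sum sum_descent_insert_max (@big_cat_nat _ _ _ i 0 n) //=.
case: (ltnP i n) => [lt_in|le_ni].
  rewrite [in RHS](big_ltn lt_in) /descents_from.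
  have -> : (\sum_(i.+1 <= j < n) j.+1 * descent g j =
     \sum_(i.+1 <= j < n) j * descent g j + \sum_(i.+1 <= j < n) descent g j)%N.
    by rewrite -big_split; apply: eq_bigr => j _; rewrite mulSn addnC.
  by case: (descent g i) (c : nat) => [] [] /=; lia.
rewrite (@big_geq _ _ _ i n) // !addn0; congr (_ + _)%N.
by rewrite mulnC; congr (_ * _)%N; lia.
Qed.

(** * The recurrence for the generating polynomials *)

(** [genpolyG] with free arguments, since the recurrence also evaluates it at $z u^r$. *)
Definition colored_gen {K : fieldType} (r n : nat) (z u : K) : K :=
  \sum_(g : colperm r n) z ^+ desG g * u ^+ fmaj g.

(* The factor [u^r] for the colour 0 accounts for the descent that a letter of
   colour 0 creates after itself, one place further than one of colour [c > 0]:
   the exponents run through [1, ..., r]. *)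
Lemma sum_color {K : fieldType} (r : nat) (u : K) : (0 < r)%N ->
  (1 - u) * (\sum_(c < r) u ^+ (r * (c == 0 :> nat) + c)) = u * (1 - u ^+ r).
Proof.
case: r => // r _.
rewrite big_ord_recl /= muln1 addn0.
under eq_bigr => c _ do rewrite /bump /= muln0 add0n add1n exprS.
rewrite -mulr_sumr mulrDr mulrCA -[in X in _ + X](opprB u) mulNr -subrX1 exprS; ring.
Qed.

(** One of the two differences always vanishes: the second if [g] has a descent at [i], the first if
    not. Keeping both gives a single expression that telescopes in [i]. *)
Lemma colored_gen_slot {K : fieldType} (r n : nat) (z u : K) (g : colperm r n)
    (i : 'I_n) : (0 < r)%N ->
  (1 - u) * (\sum_(c < r)
     z ^+ desG (insert_max (widen_ord (leqnSn n) i) c g) *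
     u ^+ fmaj (insert_max (widen_ord (leqnSn n) i) c g)) =
  z ^+ desG g * u ^+ fmaj g * u *
   (((u ^+ r) ^+ descents_from g i.+1 - (u ^+ r) ^+ descents_from g i) -
    z * ((u ^+ r) ^+ (descents_from g i.+1 + i.+1) -
         (u ^+ r) ^+ (descents_from g i + i))).
Proof.
move=> r_gt0.
have -> : descents_from g i = (descent g i + descents_from g i.+1)%N.
  by rewrite /descents_from big_ltn.
have E c : z ^+ desG (insert_max (widen_ord (leqnSn n) i) c g) *
     u ^+ fmaj (insert_max (widen_ord (leqnSn n) i) c g) =
   z ^+ desG g * u ^+ fmaj g * (z ^+ (~~ descent g i) *
     (u ^+ r) ^+ (descents_from g i.+1 + ~~ descent g i * i)) *
     u ^+ (r * (c == 0 :> nat) + c).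
  rewrite desG_insert_max /fmaj majG_insert_max colG_insert_max /= ltn_ord.
  rewrite [X in _ = X * _]mulrACA -[RHS]mulrA -exprM -!exprD; congr (_ * _ ^+ _); lia.
under eq_bigr => c _ do rewrite E.
rewrite -mulr_sumr mulrCA sum_color // -!mulrA; congr (_ * (_ * _)).
move: (u ^+ r) => t.
case: descent; rewrite /= ?mul1n ?mul0n !exprD ?expr0 ?expr1 ?exprS;
  move: (t ^+ descents_from g i.+1) (t ^+ i) => C D; ring.
Qed.

(** At the end colour 0 creates no descent and each other colour one at $n$; moreover $(1-u)(u +
    \dots + u^{r-1}) = u - u^r$. *)
Lemma colored_gen_last_slot {K : fieldType} (r n : nat) (z u : K)
    (g : colperm r n) : (0 < r)%N ->
  (1 - u) * (\sum_(c < r) z ^+ desG (insert_max ord_max c g) *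
     u ^+ fmaj (insert_max ord_max c g)) =
  z ^+ desG g * u ^+ fmaj g * ((1 - u) + z * (u ^+ r) ^+ n * (u - u ^+ r)).
Proof.
move=> r_gt0.
have E c : z ^+ desG (insert_max ord_max c g) * u ^+ fmaj (insert_max ord_max c g) =
    z ^+ desG g * u ^+ fmaj g * (z ^+ (0 < c)%N * u ^+ (r * n * (0 < c) + c)).
  rewrite desG_insert_max /fmaj majG_insert_max colG_insert_max /= ltnn.
  rewrite mulrACA -!exprD; congr (_ * _ ^+ _); lia.
under eq_bigr => c _ do rewrite E.
rewrite -mulr_sumr mulrCA; congr (_ * _).
case: r r_gt0 {g E} => // r _; rewrite big_ord_recl /= muln0 !expr0 mulr1 mulrDr mulr1.
congr (_ + _).
under eq_bigr => c _ do rewrite /bump /= add1n expr1 muln1 exprD exprM mulrA [_ ^+ c.+1]exprS mulrA.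
rewrite -mulr_sumr mulrCA -[1 - u]opprB mulNr -subrX1 exprS; ring.
Qed.

(** With $t = u^r$ and [g] fixed, all slots together contribute the factor $(1 - zt^{n+1}) -
    u(1-z)t^{\mathrm{des}(g)}$; the power of $t$ merges with $z^{\mathrm{des}(g)}$ and yields the
    argument $zt$. *)
Lemma colored_gen_rec {K : fieldType} (r n : nat) (z u : K) : (0 < r)%N ->
  (1 - u) * colored_gen r n.+1 z u =
  (1 - z * (u ^+ r) ^+ n.+1) * colored_gen r n z u -
  u * (1 - z) * colored_gen r n (z * u ^+ r) u.
Proof.
move=> r_gt0.
rewrite /colored_gen (reindex _ (onW_bij _ (insert_max_bij r n))) /=.
rewrite -(pair_bigA _ (fun x g => z ^+ desG (insert_max x.1 x.2 g) *
  u ^+ fmaj (insert_max x.1 x.2 g))) /=.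
rewrite exchange_big /= !mulr_sumr -sumrB; apply: eq_bigr => g _.
rewrite -(pair_bigA _ (fun i c => z ^+ desG (insert_max i c g) *
  u ^+ fmaj (insert_max i c g))) /=.
rewrite big_ord_recr mulrDr mulr_sumr /= colored_gen_last_slot //.
under eq_bigr => i _ do rewrite (colored_gen_slot _ _ z u g i r_gt0).
pose t := u ^+ r; rewrite -/t.
rewrite -mulr_sumr sumrB -mulr_sumr.
rewrite -(big_mkord xpredT (fun i => t ^+ descents_from g i.+1 - t ^+ descents_from g i)).
rewrite -(big_mkord xpredT (fun i => t ^+ (descents_from g i.+1 + i.+1) -
   t ^+ (descents_from g i + i))).
rewrite (telescope_sumr (fun i => t ^+ descents_from g i)) //.
rewrite (telescope_sumr (fun i => t ^+ (descents_from g i + i))) //.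
rewrite addn0 /descents_from -desG_sum big_geq // add0n expr0.
rewrite exprMn exprS; move: (z ^+ desG g) (u ^+ fmaj g) (t ^+ desG g) (t ^+ n) => A B C D.
ring.
Qed.

Lemma colored_gen0 {K : fieldType} (r : nat) (z u : K) : colored_gen r 0 z u = 1.
Proof.
rewrite /colored_gen (eq_bigr (fun=> 1)) => [|g _]; last first.
  by rewrite /fmaj desG_sum majG_sum /colG big_ord0 !big_geq // muln0 !expr0 mulr1.
by rewrite sumr_const card_prod card_ffun !card_ord card_Sn expn0 fact0.
Qed.

Lemma colored_gen_geom_form {K : fieldType} (r n : nat) (z u : K) :
  (0 < r)%N -> u != 1 -> (forall i, z * (u ^+ r) ^+ i != 1) ->
  colored_gen r n z u = qpoch z (u ^+ r) n.+1 *
    geom_form z (u ^+ r) (((1 - u)^-1 *: (1 - u *: 'X)) ^+ n).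
Proof.
move=> r_gt0 u_neq1; have u1 : 1 - u != 0 by rewrite subr_eq0 eq_sym.
elim: n z => [|n IHn] z zt_neq1.
  rewrite colored_gen0 qpoch_recr qpoch0 mul1r (_ : _ ^+ 0 = 'X^0) ?expr0 //.
  have := geom_formXn z (u ^+ r) 0; rewrite expr0 => ->.
  by rewrite divff // subr_eq0 eq_sym -(expr0 (u ^+ r)) zt_neq1.
apply: (mulfI u1); rewrite colored_gen_rec // !IHn //; last first.
  by move=> i; rewrite -mulrA -exprS.
set t := u ^+ r; set f := _ *: _.
have -> : geom_form z t (f ^+ n.+1) =
    (1 - u)^-1 * (geom_form z t (f ^+ n) - u * geom_form (z * t) t (f ^+ n)).
  rewrite exprSr {2}/f -scalerAr linearZ /= mulrBr mulr1 linearB /= -scalerAr linearZ /=.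
  by rewrite geom_formMX.
rewrite [qpoch z t n.+2]qpoch_recr.
(* The two factorizations of $(z;t)_{n+2}$, from either end, bring both terms of the recurrence to
   the same product. *)
have e := qpoch_recr z t n.+1; rewrite qpoch_recl in e.
move: (qpoch z t n.+1) (qpoch (z * t) t n.+1) e => A B e.
move: (geom_form _ _ _) (geom_form _ _ _) => C D.
rewrite [_ * (A * _ * _)]mulrCA mulVKf //.
by rewrite -[u * _ * _]mulrA [(1 - z) * _]mulrA e; ring.
Qed.

(** * The moments *)

(** The factor $1 - z$ normalizes the form, as $L_z(1) = 1/(1-z)$. *)
Definition geom_form_comp {K : fieldType} (z t : K) (s p : {poly K}) : K :=
  (1 - z) * geom_form z t (p \Po s).

Lemma geom_form_comp_is_linear {K : fieldType} (z t : K) (s : {poly K}) :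
  scalar (geom_form_comp z t s).
Proof.
by move=> a p1 p2; rewrite /geom_form_comp !linearP /= mulrDr mulrCA.
Qed.

HB.instance Definition _ (K : fieldType) (z t : K) (s : {poly K}) :=
  GRing.isLinear.Build K {poly K} K *%R (geom_form_comp z t s)
    (geom_form_comp_is_linear z t s).

(** The inverse of the substitution defining $P_n$; for $v = u^c$ it sends $u^{rk}$ to
    $[rk+c]_u$. *)
Definition qline {K : fieldType} (u v : K) : {poly K} := (1 - u)^-1 *: (1 - v *: 'X).

Lemma linear_comp_inv {K : fieldType} (u v : K) : u != 1 -> v != 0 ->
  (v^-1 *: (1 + (u - 1) *: 'X)) \Po qline u v = 'X.
Proof.
rewrite /qline; move=> u_neq1 v_neq0; have u1 : 1 - u != 0 by rewrite subr_eq0 eq_sym.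
rewrite comp_polyZ rmorphD rmorph1 /= comp_polyZ comp_polyX scalerA.
rewrite -[u - 1]opprB mulNr divff // scaleN1r opprB addrC subrK scalerA mulVf //.
by rewrite scale1r.
Qed.

Section ShiftedMoments.
Context {K : fieldType} (t z u v : K).
Hypothesis t_neq0 : t != 0.
Hypothesis t_neq1 : forall i, t ^+ i.+1 != 1.
Hypothesis z_neq0 : z != 0.
Hypothesis zt_neq1 : forall i, z * t ^+ i != 1.
Hypothesis u_neq1 : u != 1.
Hypothesis v_neq0 : v != 0.

Let P n := little_qJacobi (z / t) 1 t n \Po (v^-1 *: (1 + (u - 1) *: 'X)).
Let phi0 : {scalar {poly K}} := geom_form_comp z t (qline u v).

Lemma geom_form_compXn n : phi0 'X^n = (1 - z) * geom_form z t (qline u v ^+ n).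
Proof. by rewrite /phi0 /= /geom_form_comp rmorphXn /= comp_polyX. Qed.

Lemma geom_form_comp1 : phi0 1 = 1.
Proof.
have := geom_form_compXn 0; rewrite !expr0 => ->.
have := geom_formXn z t 0; rewrite !expr0 mulr1 => ->; rewrite divff //.
by rewrite subr_eq0 eq_sym -[z]mulr1 -(expr0 t).
Qed.

Lemma orthogonal_shifted : orthogonal_wrt phi0 P.
Proof.
apply: (@orthogonal_little_qJacobi _ t z t_neq0 t_neq1 z_neq0 zt_neq1
  _ _ (v^-1 *: (1 + (u - 1) *: 'X)) (qline u v) (1 - z)) => //.
- by rewrite subr_eq0 eq_sym -[z]mulr1 -(expr0 t).
- rewrite size_scale ?invr_neq0 // addrC size_polyDl ?size_scale ?subr_eq0 //.
    by rewrite size_polyX.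
  by rewrite size_polyX size_poly1.
- exact: linear_comp_inv.
Qed.

Lemma shifted_moment (phi : {scalar {poly K}}) n :
  phi 1 = 1 -> orthogonal_wrt phi P ->
  phi 'X^n = (1 - z) * geom_form z t (qline u v ^+ n).
Proof.
move=> phi1 phiP; rewrite -geom_form_compXn.
exact: (orthogonal_form_unique _ _ _ phiP orthogonal_shifted phi1 geom_form_comp1).
Qed.

End ShiftedMoments.

(** Here $c = 1$, that is $v = u$. The prefactor $1 - z$ is the first factor of $(z;t)_{n+1}$, and
    the remaining ones form the denominator. *)
Lemma colored_gen_moment {K : fieldType} (r n : nat) (z u : K) :
  (0 < r)%N -> u != 1 -> (forall i, z * (u ^+ r) ^+ i != 1) ->
  (1 - z) * geom_form z (u ^+ r) (qline u u ^+ n) =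
  colored_gen r n z u / qpoch (z * u ^+ r) (u ^+ r) n.
Proof.
move=> r_gt0 u_neq1 zt_neq1; rewrite colored_gen_geom_form // qpoch_recl.
rewrite [RHS]mulrAC mulfK ?qpoch_neq0 // => i _.
by rewrite -mulrA -exprS.
Qed.

(** This exhibits the argument of $L_Z$ as a polynomial over $\mathbb{Q}(q)$, as the expansion in
    $Z$ requires. *)
Lemma qline_map {F K : fieldType} (h : {rmorphism F -> K}) (u v : F) n :
  qline (h u) (h v) ^+ n = map_poly h (qline u v ^+ n).
Proof.
rewrite rmorphXn /= /qline map_polyZ.
by rewrite [map_poly h (_ - _)]rmorphB rmorph1 /= map_polyZ map_polyX fmorphV rmorphB rmorph1.
Qed.

Lemma qline_horner {F : fieldType} (u : F) (r k n : nat) (c : int) : u != 0 ->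
  (qline u (u ^ c) ^+ n).[(u ^+ r) ^+ k] = qint u (r%:Z * k%:Z + c) ^+ n.
Proof.
move=> u0; rewrite horner_exp /qline !hornerE /qint mulrC; congr (((1 - _) / _) ^+ _).
by rewrite expfzDr // -PoszM -exprnP exprM mulrC.
Qed.

(** * The indeterminates $q$ and $Z$, and the theorem *)

Lemma tofracX_expn_neq1 {R : idomainType} (m : nat) :
  FracField.tofrac ('X : {poly R}) ^+ m.+1 != 1.
Proof.
rewrite -tofracXn -tofrac1 tofrac_eq.
by apply/eqP => /(congr1 (fun p : {poly R} => size p)); rewrite size_polyXn size_poly1.
Qed.

Lemma tofracX_mulC_neq1 {R : idomainType} (a : R) :
  FracField.tofrac ('X : {poly R}) * FracField.tofrac a%:P != 1.
Proof.
rewrite -tofracM -tofrac1 tofrac_eq.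
apply/eqP => /(congr1 (fun p : {poly R} => p`_0)).
by rewrite coefXM coef1 => /eqP; rewrite eq_sym oner_eq0.
Qed.

Notation emb := (@FracField.tofrac {poly Qq} \o polyC).

Lemma q0_neq0 : q0 != 0.
Proof. by rewrite tofrac_eq0 polyX_eq0. Qed.

Lemma q0X_neq1 (m : nat) : q0 ^+ m.+1 != 1.
Proof. exact: tofracX_expn_neq1. Qed.

Lemma qE : q = emb q0.
Proof. by []. Qed.

Lemma qX (m : nat) : q ^+ m = emb (q0 ^+ m).
Proof. by rewrite qE rmorphXn. Qed.

Lemma qX_neq1 (m : nat) : q ^+ m.+1 != 1.
Proof. by rewrite qX fmorph_eq1 q0X_neq1. Qed.

Lemma q_neq0 : q != 0.
Proof. by rewrite qE fmorph_eq0 q0_neq0. Qed.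

Lemma Z_neq0 : Z != 0.
Proof. by rewrite tofrac_eq0 polyX_eq0. Qed.

Lemma Zq_neq1 (m : nat) : Z * q ^+ m != 1.
Proof. by rewrite qX; exact: tofracX_mulC_neq1. Qed.

Lemma q_expz (c : int) : q ^ c = emb (q0 ^ c).
Proof. by rewrite (fmorphXz emb). Qed.

Theorem theorem1p4 (r : nat) (c : int) (hr : (1 <= r)%N) :
  (exists phi : {scalar {poly QqZ}},
     phi 1 = 1 /\ orthogonal_wrt phi (shifted_qJacobi r c)) /\
  (forall phi : {scalar {poly QqZ}},
     phi 1 = 1 -> orthogonal_wrt phi (shifted_qJacobi r c) ->
     (forall n : nat,
        has_expansion (phi 'X^n)
          (fps_mul (fps_of_poly (1 - 'X))
                   (fun k : nat => qint q0 (r%:Z * k%:Z + c) ^+ n))) /\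
     (c = 1 -> forall n : nat, (1 <= n)%N ->
        phi 'X^n = genpolyG r n / qpoch (Z * q ^+ r) (q ^+ r) n)).
Proof.
have hc : q ^ c != 0 by exact: expfz_neq0 q_neq0.
have t_neq0 : q ^+ r != 0 by exact: expf_neq0 q_neq0.
have t_neq1 i : (q ^+ r) ^+ i.+1 != 1.
  by rewrite -exprM mulnS -(prednK hr) addSn qX_neq1.
have Zt_neq1 i : Z * (q ^+ r) ^+ i != 1 by rewrite -exprM Zq_neq1.
have q_neq1 : q != 1 by exact: (qX_neq1 0).
have PE n : shifted_qJacobi r c n =
    little_qJacobi (Z / q ^+ r) 1 (q ^+ r) n \Po ((q ^ c)^-1 *: (1 + (q - 1) *: 'X)).
  by rewrite /shifted_qJacobi -invr_expz.
split.
  exists (geom_form_comp Z (q ^+ r) (qline q (q ^ c))); split.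
    exact: (geom_form_comp1 _ _ _ _ Zt_neq1).
  apply: (eq_orthogonal_wrt _ _ _ (fsym PE)).
  exact: (orthogonal_shifted _ _ _ _ t_neq0 t_neq1 Z_neq0 Zt_neq1 q_neq1 hc).
move=> phi phi1 /(eq_orthogonal_wrt _ _ _ PE) phiP.
have phiE n := shifted_moment _ _ _ _ t_neq0 t_neq1 Z_neq0 Zt_neq1 q_neq1 hc phi n phi1 phiP.
split=> [n|c1 n _]; rewrite phiE; last first.
  (* [genpolyG r n] is [colored_gen r n Z q] by conversion. *)
  by rewrite c1 (colored_gen_moment _ _ _ _ hr q_neq1 Zt_neq1).
have tE : q ^+ r = FracField.tofrac (q0 ^+ r)%:P by exact: qX.
rewrite q_expz {1}qE (qline_map emb) tE.
(* As the image of a polynomial in $Z$, the prefactor acts on the series by a Cauchy product. *)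
have -> : 1 - Z = FracField.tofrac (1 - 'X : {poly Qq}).
  by rewrite [RHS]tofracB tofrac1.
apply: has_expansionM.
apply: eq_has_expansion (has_expansion_geom_form _ _) => k.
exact: (qline_horner _ _ _ _ _ q0_neq0).
Qed.
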